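(* Let $K\ge 2$ be an integer and let $X$ be $\mathbb{R}^2$ equipped with a norm $\|\cdot\|_X$ whose closed unit ball $BX=\{x\in\mathbb{R}^2:\|x\|_X\le 1\}$ is a symmetric convex polygon with $2K$ sides. Then there is a set $E\subset[0,1]^2$ with Hausdorff dimension $\ge K/(K-1)$ such that the one-dimensional Lebesgue measure of $\Delta_X(E)$ is $0$.
   Context: For $E\subset X$, the $X$-distance set of $E$ is $\Delta_X(E)=\{\|x-x'\|_X: x,x'\in E\}\subset[0,\infty)$. *)

(* Defs.v *)
From HB Require Import structures.
From mathcomp Require Import all_boot all_order all_algebra.
From mathcomp Require Import all_classical all_reals all_analysis.
Set Implicit Arguments. Unset Strict Implicit. Unset Printing Implicit Defensive.
Import Order.TTheory GRing.Theory Num.Theory.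
Local Open Scope classical_set_scope.
Local Open Scope ring_scope.

Definition edist {R : realType} (x y : R * R) : R :=
  Num.sqrt ((x.1 - y.1) ^+ 2 + (x.2 - y.2) ^+ 2).

(* Euclidean diameter of a (bounded) set; used only for sets whose pairwise
   distances are bounded by delta. *)
Definition ediam {R : realType} (U : set (R * R)) : R :=
  sup [set edist x y | x in U & y in U].

Definition hcontrib {R : realType} (s : R) (U : set (R * R)) : \bar R :=
  (if U == set0 then 0 else (ediam U) `^ s)%:E.

Definition hausdorff_content {R : realType} (s delta : R) (E : set (R * R))
  : \bar R :=
  ereal_inf [set (\sum_(0 <= i <oo) hcontrib s (U i))%E |
     U in [set U : nat -> set (R * R) |
       E `<=` \bigcup_i U i /\
       forall i x y, U i x -> U i y -> edist x y <= delta]].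

Definition hausdorff_measure {R : realType} (s : R) (E : set (R * R)) : \bar R :=
  ereal_sup [set hausdorff_content s delta E | delta in [set d : R | 0 < d]].

Definition hausdorff_dim {R : realType} (E : set (R * R)) : \bar R :=
  ereal_inf [set s%:E | s in [set s : R | 0 <= s /\ hausdorff_measure s E = 0%E]].

Definition is_norm2 {R : realType} (N : R * R -> R) : Prop :=
  [/\ forall x, 0 <= N x,
      forall x, N x = 0 -> x = (0, 0),
      forall (a : R) x, N (a * x.1, a * x.2) = `|a| * N x &
      forall x y, N (x.1 + y.1, x.2 + y.2) <= N x + N y].

Definition conv_hull {R : realType} {I : finType} (v : I -> R * R) : set (R * R) :=
  [set x | exists l : I -> R,
     [/\ forall i, 0 <= l i, \sum_i l i = 1 &
         x = (\sum_i l i * (v i).1, \sum_i l i * (v i).2)]].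

(* P is a convex polygon with exactly n vertices (equivalently n sides):
   P is the convex hull of n distinct points, none of which lies in the
   convex hull of the others (so they are exactly the vertices of P). *)
Definition convex_polygon_with_sides {R : realType} (n : nat) (P : set (R * R))
  : Prop :=
  exists v : 'I_n -> R * R,
    [/\ injective v,
        forall i, ~ conv_hull (fun j : {k : 'I_n | k != i} => v (val j))
                  (v i) &
        P = conv_hull v].

Definition symmetric_set {R : realType} (P : set (R * R)) : Prop :=
  forall x, P x -> P (- x.1, - x.2).

Definition distance_set {R : realType} (N : R * R -> R) (E : set (R * R))
  : set R :=
  [set N (x.1 - y.1, x.2 - y.2) | x in E & y in E].

(* Main.v *)
(* If the unit ball has 2K sides, the norm is the maximum of K functionals up to
   sign. Take two independent ones as coordinates (u, w); the other K - 2 become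
   c (u + t w) or multiples of w. By Dirichlet there is q <= L^(K-2) with
   |q t - p| <= 1/L for all these slopes t, so that on the lattice with spacing
   1/Q in u and q/Q in w every functional is, up to an error o(1/Q), a fixed
   multiple of an integer multiple of 1/Q. Let E be the product A x B of the two
   Cantor sets made of points which, along a rapidly increasing sequence of
   scales Q, are very close to these lattices. A distance between points of E is
   then within o(1/Q) of one of O(Q) points, for infinitely many Q, so the
   distance set is null, whereas A has dimension 1 and B dimension 1/(K-1). *)
Require Import Defs.
From HB Require Import structures.
From mathcomp Require Import all_boot all_order all_algebra.
From mathcomp Require Import all_classical all_reals all_analysis.
From mathcomp Require Import zify ring lra.
Import Order.TTheory GRing.Theory Num.Theory.
Local Open Scope classical_set_scope.
Local Open Scope ring_scope.

(** * The functionals of a polygonal norm *)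

Definition dot {R : realType} (p x : R * R) : R := p.1 * x.1 + p.2 * x.2.

Definition det2 {R : realType} (a b : R * R) : R := a.1 * b.2 - a.2 * b.1.

(* [tau] is the value of the functional at [y] rotated by a right angle; any
   value between this supremum and the infimum in [t2] would do. *)
Lemma supporting_functional (R : realType) (N : R * R -> R) (y : R * R) :
  is_norm2 N -> N y = 1 ->
  exists p : R * R, dot p y = 1 /\ forall x, dot p x <= N x.
Proof.
move=> [N0 Npos Nhom Ntri] Ny.
have y0 : y.1 ^+ 2 + y.2 ^+ 2 != 0.
  apply/negP; rewrite paddr_eq0 ?sqr_ge0// !sqrf_eq0 => /andP[/eqP a /eqP b].
  have := Nhom 0 y; rewrite Ny a b !mul0r normr0 mul0r -{1}a -{1}b.
  by rewrite -surjective_pairing Ny => /eqP; rewrite oner_eq0.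
(* [g a b] is the norm of [a y + b y'], with [y'] the rotated [y]; [key] is the one-dimensional
   extension step of the Hahn-Banach theorem. *)
pose g (a b : R) := N (a * y.1 - b * y.2, a * y.2 + b * y.1).
have key a a' : a - g a (-1) <= g a' 1 - a'.
  rewrite lerBlDr addrAC lerBrDr; apply: le_trans (_ : N ((a + a') * y.1, (a + a') * y.2) <= _).
    by rewrite Nhom Ny mulr1 ler_norm.
  have := Ntri (a' * y.1 - 1 * y.2, a' * y.2 + 1 * y.1)
    (a * y.1 - -1 * y.2, a * y.2 + -1 * y.1) => /=.
  by rewrite [_ + g _ _]addrC; apply: le_trans; rewrite le_eqVlt; apply/orP; left;
    apply/eqP; congr (N (_, _)); ring.
pose S := [set a - g a (-1) | a in setT].
have Sne : S !=set0 by exists (0 - g 0 (-1)); exists 0.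
have Sub : has_sup S.
  by split=> //; exists (g 0 1 - 0) => _ [a _ <-]; exact: key.
pose tau := sup S.
have t1 a : a - g a (-1) <= tau by apply: ub_le_sup; [case: Sub|exists a].
have t2 a : tau <= g a 1 - a by apply: ge_sup => // _ [b _ <-]; exact: key.
have gM c a b : 0 < c -> g (c * a) (c * b) = c * g a b.
  move=> c0; have := Nhom c (a * y.1 - b * y.2, a * y.2 + b * y.1).
  rewrite gtr0_norm// => <- /=.
  by congr (N (_, _)); ring.
have main a b : a + b * tau <= g a b.
  have [b0|b0|->] := ltgtP b 0.
  - have nb : 0 < - b by rewrite oppr_gt0.
    have := t1 (a / - b); rewrite -(ler_pM2l nb) mulrBr -gM//.
    rewrite mulrC divfK ?gt_eqF// mulrN1 opprK.
    by lra.
  - have := t2 (a / b); rewrite -(ler_pM2l b0) mulrBr -gM//.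
    rewrite [b * (a / b)]mulrC divfK ?gt_eqF// mulr1.
    by lra.
  - rewrite mul0r addr0 /g !mul0r subr0 addr0 Nhom Ny mulr1.
    exact: ler_norm.
pose d := y.1 ^+ 2 + y.2 ^+ 2.
(* The functional equal to 1 at [y] and to [tau] at the rotated [y], in standard coordinates. *)
exists ((y.1 - tau * y.2) / d, (y.2 + tau * y.1) / d); rewrite /dot /=; split.
  by rewrite /d; field.
move=> x; have := main ((x.1 * y.1 + x.2 * y.2) / d) ((x.2 * y.1 - x.1 * y.2) / d).
have -> : g ((x.1 * y.1 + x.2 * y.2) / d) ((x.2 * y.1 - x.1 * y.2) / d) = N x.
  rewrite /g [in RHS](surjective_pairing x) /d; congr (N (_, _)); field => //.
by apply: le_trans; rewrite le_eqVlt; apply/orP; left; apply/eqP; rewrite /d; field.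
Qed.

Lemma conv_hull_point (R : realType) (I : finType) (v : I -> R * R) (i : I) :
  conv_hull v (v i).
Proof.
exists (fun k => (k == i)%:R); split => //.
  by rewrite (bigD1 i)//= eqxx big1 ?addr0// => k /negbTE ->.
have E (u : R * R -> R) : u (v i) = \sum_k (k == i)%:R * u (v k).
  by rewrite (bigD1 i)//= eqxx mul1r big1 ?addr0// => k /negbTE ->; rewrite mul0r.
by rewrite -(E (fun z => z.1)) -(E (fun z => z.2)) -surjective_pairing.
Qed.

(** If [m i] were below 1, moving [m i * v i] to the left and dividing by [1 - m i] would write
    [v i] as a convex combination of the other points. *)
Lemma extreme_weight (R : realType) (I : finType) (v : I -> R * R) (i : I)
    (m : I -> R) :
  ~ conv_hull (fun j : {k | k != i} => v (val j)) (v i) ->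
  (forall k, 0 <= m k) -> \sum_k m k = 1 ->
  v i = (\sum_k m k * (v k).1, \sum_k m k * (v k).2) -> m i = 1.
Proof.
move=> ext m0 m1 vi; apply: contra_notP ext => mi.
have sub1 (F : I -> R) : \sum_(k | k != i) F k = \sum_(j : {k | k != i}) F (val j).
  by rewrite (big_sub [pred k | k != i]).
have mi1 : 1 - m i != 0 by rewrite subr_eq0 eq_sym; apply/eqP.
have S : 1 - m i = \sum_(k | k != i) m k.
  by move: m1; rewrite (bigD1 i)//= => <-; rewrite addrAC subrr add0r.
have S0 : 0 < 1 - m i by rewrite lt_neqAle eq_sym mi1 S sumr_ge0.
exists (fun j => m (val j) / (1 - m i)); split.
- by move=> j; rewrite divr_ge0// ltW.
- by rewrite -mulr_suml -sub1 -S divff.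
- have E (w : I -> R) : w i = \sum_k m k * w k ->
      w i = \sum_(j : {k | k != i}) m (val j) / (1 - m i) * w (val j).
    rewrite (bigD1 i)//= => wi.
    have {}wi : (1 - m i) * w i = \sum_(k | k != i) m k * w k.
      by rewrite mulrBl mul1r {1}wi addrAC subrr add0r.
    transitivity ((\sum_(k | k != i) m k * w k) / (1 - m i)).
      by rewrite -wi mulrC mulKf.
    rewrite sub1 mulr_suml; apply: eq_bigr => j _; by rewrite mulrAC.
  rewrite [LHS]surjective_pairing; congr (_, _).
  + by apply: (E (fun k => (v k).1)); rewrite {1}vi.
  + by apply: (E (fun k => (v k).2)); rewrite {1}vi.
Qed.

(** Expanding [- v i] in the points [v j], and each [- v j] in turn, writes [v i] as a convex
    combination of the [v k]. Its weight at [i] must be 1, so [m j i = 1] for some [j], that is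
    [- v j = v i]. *)
Lemma vertex_antipode (R : realType) (I : finType) (v : I -> R * R) (i : I) :
  ~ conv_hull (fun j : {k | k != i} => v (val j)) (v i) ->
  symmetric_set (conv_hull v) -> exists j, v j = (- (v i).1, - (v i).2).
Proof.
move=> ext sym.
have [l [l0 l1 lv]] := sym _ (conv_hull_point _ _ v i).
have /choice[m mP] : forall j, exists m : I -> R, [/\ forall k, 0 <= m k, \sum_k m k = 1 &
    (- (v j).1, - (v j).2) = (\sum_k m k * (v k).1, \sum_k m k * (v k).2)].
  by move=> j; have := sym _ (conv_hull_point _ _ v j).
have mu : \sum_j l j * m j i = 1.
  apply: (@extreme_weight _ _ v i (fun k => \sum_j l j * m j k)) => //.
  - by move=> k; apply: sumr_ge0 => j _; rewrite mulr_ge0//; case: (mP j).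
  - rewrite exchange_big/= -[RHS]l1; apply: eq_bigr => j _.
    by rewrite -mulr_sumr; case: (mP j) => _ -> _; rewrite mulr1.
  - have E (w : I -> R) : - w i = \sum_j l j * w j ->
        (forall j, - w j = \sum_k m j k * w k) ->
        w i = \sum_k (\sum_j l j * m j k) * w k.
      move=> wi wj; rewrite -[w i]opprK wi -sumrN.
      under [RHS]eq_bigr do rewrite mulr_suml.
      rewrite exchange_big/=; apply: eq_bigr => j _.
      by rewrite -mulrN wj mulr_sumr; apply: eq_bigr => k _; rewrite mulrA.
    rewrite [LHS]surjective_pairing; congr (_, _).
    + apply: (E (fun k => (v k).1)); first by case: lv.
      by move=> j; case: (mP j) => _ _ [].
    + apply: (E (fun k => (v k).2)); first by case: lv.
      by move=> j; case: (mP j) => _ _ [].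
have [j lj] : exists j, l j != 0.
  apply/not_existsP => H; move: l1; rewrite big1; first by move/eqP; rewrite eq_sym oner_eq0.
  by move=> j _; apply/eqP/negP => /negP; apply: H.
have mle k k' : m k k' <= 1.
  have [m0 <- _] := mP k; rewrite (bigD1 k')//= lerDl sumr_ge0// => *; exact: m0.
have mj : m j i = 1.
  have : \sum_j l j * (1 - m j i) = 0.
    by under eq_bigr do rewrite mulrBr mulr1; rewrite sumrB l1 mu subrr.
  move/psumr_eq0P => /(_ (fun k _ => mulr_ge0 (l0 k) _)).
  have H k : 0 <= 1 - m k i by rewrite subr_ge0.
  move=> /(_ H j isT)/eqP; rewrite mulf_eq0 (negbTE lj)/= subr_eq0 => /eqP.
  by move=> <-.
have [m0 m1 mv] := mP j.
have mz k : k != i -> m j k = 0.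
  move: m1; rewrite (bigD1 i)//= mj => /eqP; rewrite -subr_eq0 addrAC subrr add0r => /eqP.
  by move=> + ki => /psumr_eq0P; apply.
exists j; case: mv => mv1 mv2.
have E (w : I -> R) : - w j = \sum_k m j k * w k -> w j = - w i.
  rewrite (bigD1 i)//= mj mul1r big1 ?addr0; first by move=> <-; rewrite opprK.
  by move=> k /mz ->; rewrite mul0r.
by rewrite [LHS]surjective_pairing; congr (_, _);
  [exact: (E (fun k => (v k).1))|exact: (E (fun k => (v k).2))].
Qed.

(** [p1 - p2] vanishes at [v], hence is a multiple of [det2 v]; the comparisons at [b1] and [b2], on
    the same side of [v], bound the factor by 0 from both sides. So a vertex has at most one edge
    functional on its counterclockwise side. *)
Lemma edge_functional_unique (R : realType) (v b1 b2 p1 p2 : R * R) :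
  dot p1 v = 1 -> dot p2 v = 1 -> 0 < det2 v b1 -> 0 < det2 v b2 ->
  dot p2 b1 <= dot p1 b1 -> dot p1 b2 <= dot p2 b2 -> p1 = p2.
Proof.
rewrite /dot /det2 => e1 e2 d1 d2 l1 l2.
have v0 : v.1 ^+ 2 + v.2 ^+ 2 != 0.
  apply/negP; rewrite paddr_eq0 ?sqr_ge0// !sqrf_eq0 => /andP[/eqP a /eqP b].
  by move: e1 => /eqP; rewrite a b !mulr0 addr0 eq_sym oner_eq0.
have vp : 0 < v.1 ^+ 2 + v.2 ^+ 2 by rewrite lt_neqAle eq_sym v0 addr_ge0 ?sqr_ge0.
pose q := (p1.1 - p2.1, p1.2 - p2.2); pose e := q.2 * v.1 - q.1 * v.2.
have qv : q.1 * v.1 + q.2 * v.2 = 0 by rewrite /q/=; lra.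
have id w : (q.1 * w.1 + q.2 * w.2) * (v.1 ^+ 2 + v.2 ^+ 2) = e * (v.1 * w.2 - v.2 * w.1).
  transitivity ((q.1 * v.1 + q.2 * v.2) * (v.1 * w.1 + v.2 * w.2)
    + e * (v.1 * w.2 - v.2 * w.1)); first by rewrite /e; ring.
  by rewrite qv mul0r add0r.
have e0 : 0 <= e.
  rewrite -(pmulr_lge0 _ d1) -id mulr_ge0 ?(ltW vp)// /q/=; lra.
have e0' : e <= 0.
  rewrite -(pmulr_lle0 _ d2) -id -oppr_ge0 -mulNr mulr_ge0 ?(ltW vp)// /q/=; lra.
have ez : e = 0 by apply/le_anti; rewrite e0 e0'.
have q0 w : q.1 * w.1 + q.2 * w.2 = 0.
  by have /eqP := id w; rewrite ez mul0r mulf_eq0 (negbTE v0) orbF => /eqP.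
rewrite [LHS]surjective_pairing [RHS]surjective_pairing.
have := q0 (1, 0); have := q0 (0, 1); rewrite /q/= !mulr0 !mulr1 addr0 add0r.
by move=> /subr0_eq -> /subr0_eq ->.
Qed.

(** A half of the plane containing exactly one of [x] and [- x] for nonzero [x]; it selects one
    vertex of each antipodal pair. *)
Definition lexpos {R : realType} (x : R * R) := (0 < x.1) || ((x.1 == 0) && (0 < x.2)).

Lemma lexposN (R : realType) (x : R * R) :
  x != (0, 0) -> lexpos (- x.1, - x.2) = ~~ lexpos x.
Proof.
rewrite /lexpos/= !oppr_gt0 oppr_eq0; case: x => a b/=.
by rewrite xpair_eqE; case: (ltgtP a 0) => //= _; case: (ltgtP b 0).
Qed.

(** A boundary point lies on an edge or is a vertex, so one functional per vertex is enough.
    Antipodal vertices have opposite edge functionals, which halves the count. *)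
Lemma polygon_norm_functionals (R : realType) (K : nat) (N : R * R -> R) :
  is_norm2 N -> symmetric_set [set x | N x <= 1] ->
  convex_polygon_with_sides (2 * K) [set x | N x <= 1] ->
  exists (I : finType) (p : I -> R * R),
    (#|I| <= K)%N /\ forall x, exists i, N x = `|dot (p i) x|.
Proof.
move=> Nn sym [v [vinj ext BE]]; have [N0 Npos Nhom Ntri] := Nn.
have symv : symmetric_set (conv_hull v) by rewrite -BE.
have /choice[s sP] : forall i, exists j, v j = (- (v i).1, - (v i).2).
  by move=> i; apply: vertex_antipode.
have vB i : N (v i) <= 1.
  suff : [set x | N x <= 1] (v i) by [].
  rewrite BE; exact: conv_hull_point.
have NN x : N (- x.1, - x.2) = N x.
  by rewrite -[RHS]mul1r -normr1 -normrN -Nhom !mulN1r.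
pose sup_edge i (p : R * R) := exists b, [/\ forall x, dot p x <= N x,
  dot p (v i) = 1, dot p (v b) = 1 & 0 < det2 (v i) (v b)].
(* [l i] is the functional of the edge counterclockwise from [v i], failing that any supporting
   functional at [v i], and failing both the default [(0, 0)]. *)
have /choice[l lP] : forall i, exists p : R * R,
    (N (v i) = 1 -> dot p (v i) = 1) /\ (forall p', sup_edge i p' -> p' = p).
  move=> i; have [[p [b [pN pi pb db]]]|H] := pselect (exists p, sup_edge i p).
    exists p; split=> // p' [b' [pN' pi' pb' db']].
    apply: (@edge_functional_unique _ (v i) (v b') (v b)) => //.
      by rewrite pb' (le_trans (pN _)).
    by rewrite pb (le_trans (pN' _)).
  have [vi|vi] := pselect (N (v i) = 1).
    have [p [pv _]] := @supporting_functional _ _ _ Nn vi; exists p; split=> // p' Hp.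
    by exfalso; apply: H; exists p'.
  by exists (0, 0); split=> // p' Hp; exfalso; apply: H; exists p'.
exists {i | lexpos (v i)}, (fun i => l (val i)); split.
  rewrite card_sig.
  (* The antipodal map [s] injects the selected vertices into the others, so they are at most half
     of [2 * K]. *)
  have H : (#|[pred i | lexpos (v i)]| <= #|predC [pred i | lexpos (v i)]|)%N.
    have sinj : injective s.
      move=> i j /(congr1 v); rewrite !sP => -[/oppr_inj e1 /oppr_inj e2].
      by apply: vinj; rewrite [LHS]surjective_pairing [RHS]surjective_pairing e1 e2.
    rewrite -(card_in_image (f := s)) => [|i j _ _]; [|exact: sinj].
    apply: subset_leq_card; apply/fintype.subsetP => j.
    move=> /fintype.imageP[i]; rewrite !inE => vi ->; rewrite sP lexposN ?negbK//.
    by apply: contraTneq vi => ->; rewrite /lexpos/= !ltxx andbF.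
  have := cardC [pred i | lexpos (v i)]; rewrite card_ord => C.
  by move: H C; move: #|_| #|_| => n n'; lia.
(* The normalised [x] is a convex combination of vertices, and those of nonzero weight lie on the
   line where [p] is 1. Two independent ones give an edge, ordered counterclockwise; otherwise all
   coincide and the point is a vertex. *)
have key x : N x != 0 -> exists a (p : R * R), [/\ forall x, dot p x <= N x,
    dot p x = N x, dot p (v a) = 1 &
    (exists b, dot p (v b) = 1 /\ 0 < det2 (v a) (v b)) \/
      v a = ((N x)^-1 * x.1, (N x)^-1 * x.2)].
  move=> Nx; pose y := ((N x)^-1 * x.1, (N x)^-1 * x.2).
  have Ny : N y = 1.
    by rewrite /y Nhom ger0_norm ?invr_ge0// mulVf.
  have [p [py pN]] := @supporting_functional _ _ _ Nn Ny.
  have px : dot p x = N x.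
    by apply: (mulfI (invr_neq0 Nx)); rewrite mulVf// -py /dot /y/=; ring.
  have : conv_hull v y by rewrite -BE /= Ny.
  move=> [w [w0 w1 yw]].
  have pw : \sum_i w i * dot p (v i) = 1.
    rewrite -py yw /dot/= !mulr_sumr -big_split/=; apply: eq_bigr => i _; ring.
  have pv i : w i != 0 -> dot p (v i) = 1.
    move=> wi; have : \sum_i w i * (1 - dot p (v i)) = 0.
      by under eq_bigr do rewrite mulrBr mulr1; rewrite sumrB w1 pw subrr.
    move/psumr_eq0P => H.
    have {}H : w i * (1 - dot p (v i)) = 0.
      by apply: H => // j _; rewrite mulr_ge0// subr_ge0 (le_trans (pN _)).
    by move/eqP: H; rewrite mulf_eq0 (negbTE wi)/= subr_eq0 => /eqP.
  have [a wa] : exists a, w a != 0.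
    apply/not_existsP => H; move: w1; rewrite big1; first by move/eqP; rewrite eq_sym oner_eq0.
    by move=> j _; apply/eqP/negP => /negP; apply: H.
  have [[b [wb dab]]|H] := pselect (exists b, w b != 0 /\ det2 (v a) (v b) != 0).
    have [d0|d0] := ltP 0 (det2 (v a) (v b)).
      by exists a, p; split; rewrite ?pv//; left; exists b; rewrite pv.
    exists b, p; split; rewrite ?pv//; left; exists a; rewrite pv//; split=> //.
    have -> : det2 (v b) (v a) = - det2 (v a) (v b) by rewrite /det2; ring.
    by rewrite oppr_gt0 lt_neqAle dab.
  exists a, p; split; rewrite ?pv//; right.
  have vab b : w b != 0 -> v b = v a.
    move=> wb; have [/eqP d0|dn] := boolP (det2 (v a) (v b) == 0); last first.
      by exfalso; apply: H; exists b.
    have := pv _ wa; have := pv _ wb; move: d0; rewrite /dot/det2 => d0 pb pa.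
    rewrite [LHS]surjective_pairing [RHS]surjective_pairing; congr (_, _).
      transitivity ((p.1 * (v a).1 + p.2 * (v a).2) * (v b).1); first by rewrite pa mul1r.
      transitivity ((p.1 * (v b).1 + p.2 * (v b).2) * (v a).1
         - p.2 * ((v a).1 * (v b).2 - (v a).2 * (v b).1)); first by ring.
      by rewrite pb d0; ring.
    transitivity ((p.1 * (v a).1 + p.2 * (v a).2) * (v b).2); first by rewrite pa mul1r.
    transitivity ((p.1 * (v b).1 + p.2 * (v b).2) * (v a).2
         + p.1 * ((v a).1 * (v b).2 - (v a).2 * (v b).1)); first by ring.
    by rewrite pb d0; ring.
  have E (u : R * R -> R) : \sum_i w i * u (v i) = u (v a).
    rewrite -[RHS]mul1r -w1 mulr_suml; apply: eq_bigr => i _.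
    by have [->|/vab ->//] := eqVneq (w i) 0; rewrite !mul0r.
  by rewrite -/y yw (E (fun z => z.1)) (E (fun z => z.2)) -surjective_pairing.
have pos x : N x != 0 -> exists i : {i | lexpos (v i)}, N x = `|dot (l (val i)) x|.
  move=> Nx; have [a [p [pN px pa ab]]] := key x Nx.
  have va0 : v a != (0, 0).
    apply: contra_eq_neq pa => ->; rewrite /dot/= !mulr0 addr0.
    by rewrite eq_sym oner_eq0.
  have [la|la] := boolP (lexpos (v a)).
    exists (Sub a la); rewrite SubK; case: ab => [[b [pb dab]]|ay].
      by rewrite -((lP a).2 p) ?px ?ger0_norm//; exists b.
    have : N (v a) = 1 by rewrite ay Nhom ger0_norm ?invr_ge0// mulVf.
    move/(lP a).1; rewrite ay /dot/= => H.
    have -> : (l a).1 * x.1 + (l a).2 * x.2 = N x.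
      by apply: (mulfI (invr_neq0 Nx)); rewrite mulVf// -H; ring.
    by rewrite ger0_norm.
  (* Otherwise pass to the antipode of [v a], where [- p] is the edge functional if [p] was one at
     [v a]. *)
  have ls : lexpos (v (s a)) by rewrite sP lexposN.
  exists (Sub (s a) ls); rewrite SubK; case: ab => [[b [pb dab]]|ay].
    rewrite -((lP (s a)).2 (- p.1, - p.2)).
      have -> : dot (- p.1, - p.2) x = - dot p x by rewrite /dot/=; ring.
      by rewrite px normrN ger0_norm.
    exists (s b); split.
    - move=> z; rewrite -NN; apply: le_trans (pN _).
      by rewrite le_eqVlt; apply/orP; left; apply/eqP; rewrite /dot/=; ring.
    - by rewrite sP -pa /dot/=; ring.
    - by rewrite sP -pb /dot/=; ring.
    - by rewrite !sP; congr (0 < _): dab; rewrite /det2/=; ring.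
  have : N (v (s a)) = 1 by rewrite sP NN ay Nhom ger0_norm ?invr_ge0// mulVf.
  move/(lP (s a)).1; rewrite sP ay /dot/= => H.
  have -> : (l (s a)).1 * x.1 + (l (s a)).2 * x.2 = - N x.
    by apply: (mulfI (invr_neq0 Nx)); rewrite mulrN mulVf// -H; ring.
  by rewrite normrN ger0_norm.
move=> x; have [Nx|] := eqVneq (N x) 0; last exact: pos.
(* At the origin any index serves; a nonzero vector provides one. *)
have [|i _] := pos (1, 0).
  by apply/eqP => /Npos [] /eqP; rewrite oner_eq0.
by exists i; rewrite Nx (Npos _ Nx) /dot/= !mulr0 addr0 normr0.
Qed.

(** [e] and [f] form the scaled dual basis of [p i1] and [p i2]; these are independent because
    [p i2] attains the norm at a nonzero vector of the kernel of [p i1]. Each functional is divided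
    by its coefficient of [u], or by that of [w] if the former is 0. *)
Lemma adapted_coordinates (R : realType) (N : R * R -> R) (I : finType) (p : I -> R * R) :
  is_norm2 N -> (forall x, exists i, N x = `|dot (p i) x|) ->
  exists (e f : R * R) (i1 i2 : I) (kap t : I -> R) (gam : I -> bool),
    [/\ det2 e f != 0, `|e.1| + `|f.1| <= 2^-1 /\ `|e.2| + `|f.2| <= 2^-1,
        [/\ i1 != i2, t i1 = 0 & t i2 = 1] &
        forall u w, exists k,
          N (u * e.1 + w * f.1, u * e.2 + w * f.2) = `|kap k * ((gam k)%:R * u + t k * w)|].
Proof.
move=> [N0 Npos Nhom Ntri] Np.
have [i1 Hi1] := Np (1, 0).
pose z := (- (p i1).2, (p i1).1).
have [i2 Hi2] := Np z.
have Nz : N z != 0.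
  apply/eqP => /Npos [] a b; move: Hi1; rewrite /dot b mul0r mulr0 addr0 normr0.
  by move=> /Npos [] /eqP; rewrite oner_eq0.
pose D := (p i1).1 * (p i2).2 - (p i1).2 * (p i2).1.
have D0 : D != 0.
  have -> : D = dot (p i2) z.
    by rewrite /dot /D /z/=; ring.
  by rewrite -normr_eq0 -Hi2.
have i12 : i1 != i2.
  by apply: contraNneq D0 => e; rewrite /D e; apply/eqP; ring.
pose e0 := ((p i2).2 / D, - (p i2).1 / D); pose f0 := (- (p i1).2 / D, (p i1).1 / D).
pose M : R := `|e0.1| + `|f0.1| + (`|e0.2| + `|f0.2|).
have M0 : 0 <= M by rewrite /M !addr_ge0.
(* This factor lets the image of the unit square, shifted to the centre [(1/2, 1/2)], fit into the
   unit square. *)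
pose c : R := (2 * (1 + M))^-1.
have c0 : 0 < c by rewrite /c invr_gt0; lra.
have cM a : 0 <= a -> a <= M -> c * a <= 2^-1.
  move=> a0 aM; rewrite /c invfM -mulrA ler_piMr ?invr_ge0// mulrC ler_pdivrMr; lra.
pose al k := dot (p k) e0 * c; pose be k := dot (p k) f0 * c.
exists (c * e0.1, c * e0.2), (c * f0.1, c * f0.2), i1, i2.
exists (fun k => if al k == 0 then be k else al k), (fun k => if al k == 0 then 1 else be k / al k),
  (fun k => al k != 0) => /=.
have al1 : al i1 = c.
  by rewrite /al /dot /e0/= -[RHS]mul1r; congr (_ * _); rewrite /D; field.
have be1 : be i1 = 0 by rewrite /be /dot /f0/= /D; field.
have al2 : al i2 = 0 by rewrite /al /dot /e0/= /D; field.
split.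
- rewrite /det2/=.
  have -> : c * e0.1 * (c * f0.2) - c * e0.2 * (c * f0.1) = c ^+ 2 / D.
    by rewrite /e0 /f0/= /D; field.
  by rewrite mulf_neq0 ?invr_neq0// expf_neq0// gt_eqF.
- rewrite !(normrM c) (gtr0_norm c0) -!mulrDr.
  have [Ma Mb] : `|e0.1| + `|f0.1| <= M /\ `|e0.2| + `|f0.2| <= M.
    by rewrite /M lerDl lerDr !addr_ge0.
  by split; apply: cM; rewrite ?addr_ge0.
- by rewrite al1 be1 al2 eqxx (gt_eqF c0) mul0r.
- move=> u w; have [k ->] := Np (u * (c * e0.1) + w * (c * f0.1), u * (c * e0.2) + w * (c * f0.2)).
  exists k; congr `|_|.
  transitivity (al k * u + be k * w); first by rewrite /al /be /dot/=; ring.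
  by have [->|a0] := eqVneq (al k) 0 => /=; [ring|field].
Qed.

(** * Cantor sets with prescribed digits *)

(* Numerator over [\prod_(i < n) (b i * c i)] of the expansion whose [n]-th
   digits are, alternately, the [b]-digit of [x] and a zero in base [c n]. *)
Fixpoint cantor_num {R : realType} (b c : nat -> nat) (x : R) (n : nat) : nat :=
  if n is m.+1 then
    ((cantor_num b c x m * b m +
      (Num.truncn (x * (\prod_(i < m.+1) b i)%:R) -
       Num.truncn (x * (\prod_(i < m) b i)%:R) * b m)) * c m)%N
  else 0%N.

(** The supremum of the left endpoints of nested intervals is a point common to all of them. *)
Definition cantor_map {R : realType} (b c : nat -> nat) (x : R) : R :=
  sup (range (fun n => (cantor_num b c x n)%:R / (\prod_(i < n) (b i * c i))%:R)).

(** Thus the truncated subtraction in [cantor_num] is exact and yields a digit below [b m]. *)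
Lemma truncn_digit (R : realType) (b : nat -> nat) (x : R) (m : nat) :
  (forall i, 0 < b i)%N -> 0 <= x ->
  (Num.truncn (x * (\prod_(i < m) b i)%:R) * b m <=
   Num.truncn (x * (\prod_(i < m.+1) b i)%:R) <
   (Num.truncn (x * (\prod_(i < m) b i)%:R)).+1 * b m)%N.
Proof.
move=> b0 x0; pose k n := Num.truncn (x * (\prod_(i < n) b i)%:R).
rewrite -!/(k _).
have kP n : (k n)%:R <= x * (\prod_(i < n) b i)%:R < (k n).+1%:R.
  by rewrite truncn_itv// mulr_ge0.
have bm : 0 < (b m)%:R :> R by rewrite ltr0n.
have /andP[l u] := kP m; apply/andP; split.
  rewrite /k truncn_ge_nat ?mulr_ge0// big_ord_recr/= !natrM mulrA.
  by rewrite ler_pM2r.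
rewrite {1}/k truncn_lt_nat ?mulr_ge0// big_ord_recr/= !natrM mulrA.
by rewrite ltr_pM2r.
Qed.

(** The basic interval of level [m.+1] lies inside that of level [m]. *)
Lemma cantor_num_step (R : realType) (b c : nat -> nat) (x : R) (m : nat) :
  (forall i, 0 < b i)%N -> (forall i, 0 < c i)%N -> 0 <= x ->
  let F := cantor_num b c x in
  (F m * (b m * c m) <= F m.+1 /\ (F m.+1).+1 <= (F m).+1 * (b m * c m))%N.
Proof.
move=> b0 c0 x0 F; rewrite /F/=; have := @truncn_digit _ b x m b0 x0 => /=.
have := b0 m; have := c0 m.
move: (Num.truncn (x * (\prod_(i < m.+1) b i)%:R)) (Num.truncn (x * _)).
move: (cantor_num _ _ _ _) (b m) (c m).
move=> f b1 c1 k1 k0 hc hb /andP[h1 h2].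
have [d [ed db]] : exists d, (k1 - k0 * b1)%N = d /\ (d < b1)%N.
  by eexists; split; [reflexivity|lia].
rewrite ed; split; first by rewrite mulnA leq_mul2r; apply/orP; right; lia.
have : ((f * b1 + d).+1 * c1 <= (f.+1 * b1) * c1)%N.
  by rewrite leq_mul2r; apply/orP; right; lia.
by rewrite mulnA; lia.
Qed.

Lemma cantor_map_itv (R : realType) (b c : nat -> nat) (x : R) (n : nat) :
  (forall i, 0 < b i)%N -> (forall i, 0 < c i)%N -> 0 <= x ->
  (cantor_num b c x n)%:R / (\prod_(i < n) (b i * c i))%:R <= cantor_map b c x
    <= ((cantor_num b c x n).+1)%:R / (\prod_(i < n) (b i * c i))%:R.
Proof.
move=> b0 c0 x0.
pose P n : R := (\prod_(i < n) (b i * c i))%:R.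
have P0 k : 0 < P k by rewrite ltr0n prodn_gt0// => i; rewrite muln_gt0 b0 c0.
pose lo k := (cantor_num b c x k)%:R / P k; pose hi k := ((cantor_num b c x k).+1)%:R / P k.
have PS k : P k.+1 = P k * (b k * c k)%:R by rewrite /P big_ord_recr/= natrM.
have bc k : 0 < (b k * c k)%:R :> R by rewrite ltr0n muln_gt0 b0 c0.
have loS : {homo lo : i j / (i <= j)%N >-> i <= j}.
  apply: homo_leq => // [? ? ?|k]; first exact: le_trans.
  rewrite /lo PS ler_pdivrMr// mulrAC ler_pdivlMr ?mulr_gt0//.
  rewrite [_%:R * (P k * _)]mulrCA mulrC ler_pM2r// -natrM ler_nat.
  by have [] := @cantor_num_step _ b c x k b0 c0 x0.
have hiS : {homo hi : i j / (i <= j)%N >-> j <= i}.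
  apply: homo_leq => // [? ? ? h1 h2|k]; first exact: le_trans h2 h1.
  rewrite /hi PS ler_pdivrMr ?mulr_gt0// mulrAC ler_pdivlMr//.
  rewrite [X in _ <= X]mulrCA mulrC ler_pM2l// -natrM ler_nat.
  by have [] := @cantor_num_step _ b c x k b0 c0 x0.
have lohi i j : lo i <= hi j.
  apply: le_trans (loS _ _ (leq_maxl i j)) _.
  apply: le_trans (hiS _ _ (leq_maxr i j)).
  by rewrite /lo /hi ler_pM2r ?invr_gt0// ler_nat.
apply/andP; split.
  apply: ub_le_sup; last by exists n.
  by exists (hi n) => _ [i _ <-]; exact: lohi.
by apply: ge_sup; [exists (lo 0); exists 0%N|move=> _ [i _ <-]; exact: lohi].
Qed.

Lemma cantor_map_ge0_le1 (R : realType) (b c : nat -> nat) (x : R) :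
  (forall i, 0 < b i)%N -> (forall i, 0 < c i)%N -> 0 <= x ->
  0 <= cantor_map b c x <= 1.
Proof.
move=> b0 c0 x0; have := @cantor_map_itv _ b c x 0 b0 c0 x0.
by rewrite /= big_ord0 !divr1.
Qed.

(** The last digit, in base [c n], is zero, so the numerator at level [n.+1] is a multiple of
    [c n]. *)
Lemma cantor_map_lattice (R : realType) (b c : nat -> nat) (x : R) (n : nat) :
  (forall i, 0 < b i)%N -> (forall i, 0 < c i)%N -> 0 <= x ->
  exists j : nat,
    let Q := (\prod_(i < n) (b i * c i) * b n)%:R in
    j%:R / Q <= cantor_map b c x <= j%:R / Q + (Q * (c n)%:R)^-1.
Proof.
move=> b0 c0 x0; have := @cantor_map_itv _ b c x n.+1 b0 c0 x0.
have [j ->] : exists j, cantor_num b c x n.+1 = (j * c n)%N by eexists; reflexivity.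
rewrite -[(j * c n).+1]addn1 natrD big_ord_recr/= mulrDl mul1r !natrM => H; exists j.
have PP : 0 < (\prod_(i < n) (b i * c i))%:R :> R.
  by rewrite ltr0n prodn_gt0// => i; rewrite muln_gt0 b0 c0.
move: H; move: (\prod_(i < n) (b i * c i))%:R PP => P PP.
have bn : (b n)%:R != 0 :> R by rewrite pnatr_eq0 -lt0n.
have cn : (c n)%:R != 0 :> R by rewrite pnatr_eq0 -lt0n.
have -> : j%:R * (c n)%:R / (P * ((b n)%:R * (c n)%:R)) = j%:R / (P * (b n)%:R).
  by field; rewrite bn cn gt_eqF.
by rewrite !mulrA.
Qed.

Lemma cantor_num_digit_eq (R : realType) (b c : nat -> nat) (x y : R) (n : nat) :
  (forall m, m <= n -> Num.truncn (x * (\prod_(i < m) b i)%:R) =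
                       Num.truncn (y * (\prod_(i < m) b i)%:R))%N ->
  cantor_num b c x n = cantor_num b c y n.
Proof.
elim: n => //= n IH H; rewrite IH; last by move=> m mn; apply: H; exact: leqW.
by rewrite (H n.+1)// (H n).
Qed.

(* [n] is the first level at which the [b]-digits of [x] and [y] differ, and
   [a] the difference of these digits divided by [b n]. *)
Lemma cantor_map_separation (R : realType) (b c : nat -> nat) (x y : R) :
  (forall i, 1 < b i)%N -> (forall i, 1 < c i)%N ->
  0 <= x -> x < 1 -> 0 <= y -> y < 1 -> x != y ->
  exists (n : nat) (a : R), [/\ 0 < a <= 1,
    `|x - y| <= 2 * a / (\prod_(i < n) b i)%:R &
    a / (2 * (\prod_(i < n) (b i * c i))%:R) <= `|cantor_map b c x - cantor_map b c y|].
Proof.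
move=> b1 c1 x0 x1 y0 y1 xy.
have b0 i : (0 < b i)%N by apply: ltnW.
have c0 i : (0 < c i)%N by apply: ltnW.
pose k (z : R) n := Num.truncn (z * (\prod_(i < n) b i)%:R).
have kP z n : 0 <= z -> (k z n)%:R <= z * (\prod_(i < n) b i)%:R < (k z n).+1%:R.
  by move=> z0; rewrite truncn_itv// mulr_ge0.
have B0 n : 0 < (\prod_(i < n) b i)%:R :> R by rewrite ltr0n prodn_gt0.
have ex : exists n, k x n != k y n.
  apply: contrapT => /forallNP H.
  have {}H n : k x n = k y n by apply/eqP/negP => /negP; apply: H.
  have d0 : 0 < `|x - y| by rewrite normr_gt0 subr_eq0.
  (* For this [n] the product is at least [2 ^ n], hence above the inverse of the distance, while
     equal truncations keep the distance below the inverse of the product. *)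
  pose n := Num.truncn (`|x - y|^-1).
  have nB : (n < \prod_(i < n) b i)%N.
    apply: leq_trans (ltn_expl n (isT : (1 < 2)%N)) _.
    rewrite -[X in (_ ^ X <= _)%N]card_ord -prod_nat_const; apply: leq_prod => i _; exact: b1.
  have : `|x - y| * (\prod_(i < n) b i)%:R < 1.
    rewrite -[X in _ * X](gtr0_norm (B0 n)) -normrM mulrBl ltr_norml.
    have /andP[h1 h2] := kP x n x0; have /andP[h3 h4] := kP y n y0.
    move: h1 h2 h3 h4; rewrite H -[(k y n).+1]addn1 natrD => *; apply/andP; split; lra.
  apply/negP; rewrite -leNgt -ler_pdivrMl// mulr1.
  apply: ltW; apply: lt_le_trans (truncnS_gt _) _.
  by rewrite ler_nat.
wlog : x y x0 x1 y0 y1 xy ex /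
    exists m, (forall i, i <= m -> k x i = k y i)%N /\ (k x m.+1 < k y m.+1)%N.
  move=> W; have := ex_minnP ex => -[[|m] km mmin].
    (* At level 0 both truncations are 0, so the first differing level is a successor. *)
    have kz z : 0 <= z -> z < 1 -> k z 0%N = 0%N.
      by move=> z0 z1; apply: truncn_def; rewrite big_ord0 mulr1 z0 z1.
    by move: km; rewrite !kz.
  have ke i : (i <= m)%N -> k x i = k y i.
    by move=> im; apply/eqP/negP => /negP/mmin; rewrite leqNgt ltnS im.
  move: km; rewrite neq_ltn => /orP[l|l]; first by apply: W => //; exists m.
  have [|||||||n [a]] := W y x => //.
  - by rewrite eq_sym.
  - by exists m.+1; rewrite neq_ltn l.
  - by exists m; split=> // i /ke.
  - by move=> [a1 h1 h2]; exists n, a; split; rewrite // distrC.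
move=> [m [ke kl]].
have /andP[dx1 dx2] := @truncn_digit _ b x m b0 x0.
have /andP[dy1 dy2] := @truncn_digit _ b y m b0 y0.
move: dx1 dx2 dy1 dy2; rewrite -!/(k _ _) -(ke m)// => dx1 dx2 dy1 dy2.
have [j ej] : exists j, (k y m.+1 = k x m.+1 + j)%N by exists (k y m.+1 - k x m.+1)%N; lia.
have j0 : (0 < j)%N by lia.
have jb : (j <= b m)%N by lia.
have eF : cantor_num b c y m.+1 = (cantor_num b c x m.+1 + j * c m)%N.
  rewrite /= -!/(k _ _) -(@cantor_num_digit_eq _ b c x y m)// -(ke m)// ej.
  by rewrite -mulnDl; congr (_ * _)%N; lia.
have bm : 0 < (b m)%:R :> R by rewrite ltr0n.
have cm : 0 < (c m)%:R :> R by rewrite ltr0n.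
have jR : 1 <= j%:R :> R by rewrite ler1n.
exists m, (j%:R / (b m)%:R); split.
- by rewrite divr_gt0//= ?ltr0n// ler_pdivrMr// mul1r ler_nat.
- have -> : 2 * (j%:R / (b m)%:R) / (\prod_(i < m) b i)%:R = 2 * j%:R / (\prod_(i < m.+1) b i)%:R :> R.
    by rewrite [in RHS]big_ord_recr/= natrM; field; rewrite ?(lt0r_neq0 bm) ?(lt0r_neq0 (B0 _)).
  rewrite ler_pdivlMr// -[X in _ * X](gtr0_norm (B0 _)) -normrM mulrBl ler_norml.
  have /andP[h1 h2] := kP x m.+1 x0; have /andP[h3 h4] := kP y m.+1 y0.
  move: h1 h2 h3 h4; rewrite ej -[(k x m.+1 + j).+1]addn1 -[(k x m.+1).+1]addn1 !natrD.
  by move=> *; apply/andP; split; lra.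
have /andP[_ hx] := @cantor_map_itv _ b c x m.+1 b0 c0 x0.
have /andP[hy _] := @cantor_map_itv _ b c y m.+1 b0 c0 y0.
have P0 : 0 < (\prod_(i < m) (b i * c i))%:R :> R.
  by rewrite ltr0n prodn_gt0// => i; rewrite muln_gt0 b0 c0.
rewrite distrC; apply: le_trans (ler_norm _).
apply: le_trans (lerB hy hx); rewrite eF -mulrBl.
move: (cantor_num b c x m.+1) => F; rewrite big_ord_recr/=.
rewrite -[F.+1]addn1 !natrD opprD addrA [_ + (_ * _)%:R]addrC addrK !natrM.
rewrite ler_pdivlMr ?mulr_gt0//.
have -> : j%:R / (b m)%:R / (2 * (\prod_(i < m) (b i * c i))%:R) *
   ((\prod_(i < m) (b i * c i))%:R * ((b m)%:R * (c m)%:R)) = j%:R * (c m)%:R / 2 :> R.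
  by field; rewrite !lt0r_neq0//.
(* The interval of [x] takes one unit from the gap [j * c m]; as [c m] is at least 2, half of the
   gap remains. *)
have : 2 <= j%:R * (c m)%:R :> R by rewrite -natrM ler_nat (leq_trans (c1 m))// leq_pmull.
by lra.
Qed.

(** Let [B] and [P] be the products of the [b i] and of the [b i * c i] at the separation level. The
    images are at least [a / (2 P)] apart, [a / 2] is at most its power [s], and [P ^ s] is at most
    [C * B]. *)
Lemma cantor_map_hoelder (R : realType) (b c : nat -> nat) (s C : R) :
  (forall i, 1 < b i)%N -> (forall i, 1 < c i)%N -> 0 <= s <= 1 ->
  (forall n, (\prod_(i < n) (b i * c i))%:R `^ s <= C * (\prod_(i < n) b i)%:R) ->
  forall x y, 0 <= x < 1 -> 0 <= y < 1 ->
  `|x - y| <= 4 * C * `|cantor_map b c x - cantor_map b c y| `^ s.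
Proof.
move=> b1 c1 /andP[s0 s1] HC x y /andP[x0 x1] /andP[y0 y1].
have C1 : 1 <= C by have := HC 0%N; rewrite !big_ord0 powR1 mulr1.
have C0 : 0 <= 4 * C by lra.
have [->|xy] := eqVneq x y; first by rewrite subrr normr0 mulr_ge0 ?powR_ge0.
have [n [a [/andP[a0 a1] h1 h2]]] := @cantor_map_separation _ b c x y b1 c1 x0 x1 y0 y1 xy.
apply: (le_trans h1).
have B0 : 0 < (\prod_(i < n) b i)%:R :> R.
  by rewrite ltr0n prodn_gt0// => i; apply: ltnW.
have P0 : 0 < (\prod_(i < n) (b i * c i))%:R :> R.
  by rewrite ltr0n prodn_gt0// => i; rewrite muln_gt0 (ltnW (b1 i)) (ltnW (c1 i)).
have := HC n; move: B0 P0 h2.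
move: (\prod_(i < n) b i)%:R (\prod_(i < n) (b i * c i))%:R => B P B0 P0 h2 hC.
have Ps : 0 < P `^ s by rewrite powR_gt0.
have l1 : a / (2 * P ) = (a / 2) * P^-1 by field; rewrite !lt0r_neq0.
have l2 : (a / (2 * P)) `^ s = (a / 2) `^ s / P `^ s.
  rewrite l1 powRM ?invr_ge0 ?(ltW P0) ?divr_ge0 ?(ltW a0)//; congr (_ * _).
  apply: (mulfI (lt0r_neq0 Ps)); rewrite divff ?lt0r_neq0// -powRM ?(ltW P0) ?invr_ge0 ?(ltW P0)//.
  by rewrite divff ?lt0r_neq0// powR1.
have l3 : a / 2 <= (a / 2) `^ s.
  by apply: ger1_powR => //; apply/andP; split; lra.
have l4 : (a / (2 * P)) `^ s <= `|cantor_map b c x - cantor_map b c y| `^ s.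
  apply: ge0_ler_powR => //; rewrite ?nnegrE// l1 mulr_ge0 ?invr_ge0 ?(ltW P0)//.
  by rewrite divr_ge0 ?(ltW a0).
apply: (@le_trans _ _ (4 * C * ((a / 2) / P `^ s))); last first.
  rewrite ler_pM2l; last by lra.
  by apply: le_trans l4; rewrite l2 ler_pM2r ?invr_gt0.
rewrite ler_pdivrMr//.
have -> : 4 * C * (a / 2 / P `^ s) * B = 2 * a * (C * B / P `^ s).
  by field; rewrite !lt0r_neq0.
by rewrite ler_peMr ?mulr_ge0 ?(ltW a0)// ler_pdivlMr// mul1r.
Qed.

(** The hypothesis bounds [P n.+1] by [b n] to the power [D + 1 / (n + 1)]. Raising to [lam / D]
    gives the exponent [lam + lam / (D (n + 1))], at most 1 once [1 / (n + 1)] is at most [1 - lam];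
    [C] covers the finitely many smaller indices. *)
Lemma growth_hoelder_exponent (R : realType) (b : nat -> nat) (P : nat -> nat) (D : nat) (lam : R) :
  (0 < D)%N -> (forall i, 0 < b i)%N -> (forall i, 0 < P i)%N -> 0 <= lam < 1 ->
  (forall n, P n.+1 ^ n.+1 <= b n ^ (D * n.+1).+1)%N ->
  exists C : R, forall n, (P n)%:R `^ (lam / D%:R) <= C * (\prod_(i < n) b i)%:R.
Proof.
move=> D0 b0 P0 /andP[l0 l1] HP.
have D0R : 0 < D%:R :> R by rewrite ltr0n.
pose n0 := (Num.truncn ((1 - lam)^-1)).+1.
pose F n := (P n)%:R `^ (lam / D%:R) : R.
exists (1 + \sum_(i < n0.+1) F i) => n.
have Fge i : 0 <= F i by exact: powR_ge0.
have B1 : 1 <= (\prod_(i < n) b i)%:R :> R.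
  by rewrite ler1n prodn_gt0.
have [nn|nn] := ltnP n n0.+1.
  apply: (@le_trans _ _ (1 + \sum_(i < n0.+1) F i)).
    rewrite (bigD1 (Ordinal nn))//=.
    have : 0 <= \sum_(i < n0.+1 | i != Ordinal nn) F i by rewrite sumr_ge0.
    by rewrite /F; lra.
  by rewrite ler_peMr// addr_ge0 ?sumr_ge0.
apply: (@le_trans _ _ (\prod_(i < n) b i)%:R); last first.
  by rewrite ler_peMl ?ler0n// lerDl sumr_ge0.
case: n nn {B1} => [//|n] nn.
apply: (@le_trans _ _ (b n)%:R); last first.
  by rewrite big_ord_recr/= ler_nat leq_pmull// prodn_gt0.
have n1 : 0 < n.+1%:R :> R by rewrite ltr0n.
have bn1 : 1 <= (b n)%:R :> R by rewrite ler1n.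
have -> : lam / D%:R = n.+1%:R * (lam / D%:R / n.+1%:R) :> R.
  by field; rewrite !lt0r_neq0//.
rewrite powRrM powR_mulrn ?ler0n// -natrX.
have e0 : 0 <= lam / D%:R / n.+1%:R :> R by rewrite !divr_ge0.
apply: (@le_trans _ _ ((b n ^ (D * n.+1).+1)%:R `^ (lam / D%:R / n.+1%:R))).
  by apply: ge0_ler_powR => //; rewrite ?nnegrE ?ler0n// ler_nat.
rewrite natrX -powR_mulrn ?ler0n// -powRrM -[leRHS]powRr1 ?ler0n//.
apply: ler_powR => //.
rewrite -addn1 natrD natrM.
have -> : (D%:R * n.+1%:R + 1) * (lam / D%:R / n.+1%:R) = lam + lam / (D%:R * n.+1%:R).
  by field; rewrite !lt0r_neq0//.
have l1' : 0 < 1 - lam by lra.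
rewrite -lerBrDl.
have n0R : (1 - lam)^-1 <= n.+1%:R.
  apply: ltW; apply: lt_le_trans (truncnS_gt _) _; rewrite ler_nat; exact: ltnW nn.
have n0R' : 1 <= (1 - lam) * n.+1%:R by rewrite -ler_pdivrMl// mulr1.
rewrite ler_pdivrMr ?mulr_gt0//.
have D1 : 1 <= D%:R :> R by rewrite ler1n.
by nra.
Qed.

(** * Null sets close to lattices *)

(** Intersecting covers of measure at most [2 / (n + 1)] gives a measurable null set containing
    [A]. *)
Lemma negligible_small_covers (R : realType) (A : set R) :
  (forall eps : R, 0 < eps -> exists (M : nat) (a : nat -> R) (r : R),
     [/\ 0 <= r, M%:R * r <= eps &
         forall z, A z -> exists2 l, (l < M)%N & `|z - a l| <= r]) ->
  (@lebesgue_measure R).-negligible A.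
Proof.
move=> H.
have /choice[B HB] : forall n : nat, exists B : set R, [/\ measurable B, A `<=` B &
    (@lebesgue_measure R B <= (2 * n.+1%:R^-1)%:E)%E].
  move=> n; have [|M [a [r [r0 Mr cov]]]] := H n.+1%:R^-1; first by rewrite invr_gt0.
  exists (\big[setU/set0]_(l < M) `[a l - r, a l + r]%classic); split.
  - by apply: bigsetU_measurable => l _; exact: measurable_itv.
  - move=> z /cov [l lM]; rewrite ler_distl => zl.
    rewrite -(bigcup_mkord M (fun l => `[a l - r, a l + r]%classic)); by exists l.
  - have mI l : (l < M)%N -> measurable `[a l - r, a l + r]%classic.
      by move=> _; exact: measurable_itv.
    apply: le_trans (Boole_inequality (@lebesgue_measure R) mI) _.
    rewrite (eq_bigr (fun=> (2 * r)%:E)); last first.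
      move=> l _ /=; rewrite lebesgue_measure_itv/= lte_fin.
      case: ltP => [_|h]; first by rewrite -EFinD; congr (_%:E); ring.
      by congr (_%:E); lra.
    rewrite sumEFin lee_fin sumr_const card_ord -[_ *+ _]mulr_natl.
    by rewrite mulrCA ler_pM2l.
exists (\bigcap_n B n); split.
- by apply: bigcap_measurable => // n _; case: (HB n).
- apply/le_anti; rewrite measure_ge0 andbT.
  apply/lee_addgt0Pr => e e0; rewrite add0e.
  pose n := Num.truncn (2 / e).
  have [mB _ lB] := HB n.
  apply: le_trans (_ : _ <= lebesgue_measure (B n))%E _.
    apply: le_measure; rewrite ?inE//; last by apply: bigcap_inf.
    by apply: bigcap_measurable => // k _; case: (HB k).
  apply: le_trans lB _; rewrite lee_fin ler_pdivrMr// mulrC -ler_pdivrMr//.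
  exact: ltW (truncnS_gt _).
- by move=> z Az n _; case: (HB n) => _ + _; apply.
Qed.

(* The integer [l] is [gam * i + j * p]: the [t]-multiple of the coarse lattice
   point [j q / Q] is close to the fine lattice point [j p / Q]. *)
Lemma near_lattice_combination (R : realType) (Q w q L : nat) (t d1 d2 : R)
    (p i j : int) (gam : bool) :
  (0 < Q)%N -> (0 < w)%N -> (0 < q)%N -> (q * L = Q * w)%N ->
  `|q%:R * t - p%:~R| <= L%:R^-1 ->
  `|d1 - i%:~R / Q%:R| <= (Q%:R * w%:R)^-1 ->
  `|d2 - j%:~R * q%:R / Q%:R| <= (Q%:R * w%:R)^-1 -> `|d2| <= 1 ->
  exists l : int, `|gam%:R * d1 + t * d2 - l%:~R / Q%:R| <= (3 + `|t|) / (Q%:R * w%:R).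
Proof.
move=> Q0 w0 q0 qL hp h1 h2 hd2.
have QR : 0 < Q%:R :> R by rewrite ltr0n.
have wR : 0 < w%:R :> R by rewrite ltr0n.
have qR : 0 < q%:R :> R by rewrite ltr0n.
have L0 : (0 < L)%N by have := muln_gt0 q L; rewrite qL muln_gt0 Q0 w0 q0.
have LR : 0 < L%:R :> R by rewrite ltr0n.
have qLR : q%:R * L%:R = Q%:R * w%:R :> R by rewrite -!natrM qL.
have e0 : 0 < (Q%:R * w%:R)^-1 :> R by rewrite invr_gt0 mulr_gt0.
have e1 : (Q%:R * w%:R)^-1 <= 1 :> R.
  by rewrite invf_le1 ?mulr_gt0// -natrM ler1n muln_gt0 Q0 w0.
exists (gam%:Z * i + j * p).
(* The errors come from [d1], from [d2], and from replacing [q t] by [p]. The last is multiplied by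
   a lattice point of size at most 2, whence the constant [1 + |t| + 2]. *)
have -> : gam%:R * d1 + t * d2 - (gam%:Z * i + j * p)%:~R / Q%:R =
  gam%:R * (d1 - i%:~R / Q%:R) + t * (d2 - j%:~R * q%:R / Q%:R)
   + (j%:~R * q%:R / Q%:R) * ((q%:R * t - p%:~R) / q%:R).
  rewrite intrD !intrM -pmulrn; field.
  by rewrite !lt0r_neq0.
have hj : `|j%:~R * q%:R / Q%:R : R| <= 2.
  have -> : j%:~R * q%:R / Q%:R = d2 - (d2 - j%:~R * q%:R / Q%:R) by rewrite subKr.
  by apply: le_trans (ler_normB _ _) _; lra.
have hq : `|(q%:R * t - p%:~R) / q%:R| <= (Q%:R * w%:R)^-1.
  rewrite normrM [X in _ * X]gtr0_norm ?invr_gt0// -qLR invfM mulrC.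
  by rewrite ler_pM2l ?invr_gt0.
have -> : (3 + `|t|) / (Q%:R * w%:R) =
    1 * (Q%:R * w%:R)^-1 + `|t| * (Q%:R * w%:R)^-1 + 2 * (Q%:R * w%:R)^-1.
  by ring.
apply: le_trans (ler_normD _ _) _; apply: lerD.
  apply: le_trans (ler_normD _ _) _; apply: lerD; rewrite normrM.
    by apply: ler_pM => //; case: gam; rewrite ?normr1 ?normr0.
  by apply: ler_pM.
by rewrite normrM; apply: ler_pM.
Qed.

(** At stage [n] a number [O(Q n)] of intervals of radius [O(1 / (Q n * n.+2))] cover [A], of total
    length [O(1 / n.+2)]. *)
Lemma negligible_lattice_combinations (R : realType) (A : set R) (kap t : R) (gam : bool)
    (Q q L : nat -> nat) :
  (forall n, [/\ (0 < Q n)%N, (0 < q n)%N & (q n * L n = Q n * n.+2)%N]) ->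
  (forall n, exists p : int, `|(q n)%:R * t - p%:~R| <= (L n)%:R^-1) ->
  (forall z, A z -> exists d1 d2 : R,
     [/\ z = `|kap * (gam%:R * d1 + t * d2)|, `|d1| <= 1, `|d2| <= 1 &
       forall n, exists i j : int, `|d1 - i%:~R / (Q n)%:R| <= ((Q n)%:R * n.+2%:R)^-1 /\
         `|d2 - j%:~R * (q n)%:R / (Q n)%:R| <= ((Q n)%:R * n.+2%:R)^-1]) ->
  (@lebesgue_measure R).-negligible A.
Proof.
move=> HQ Hp HA; apply: negligible_small_covers => eps eps0.
(* The combination is at most [1 + |t|] and the error at most [3 + |t|], so [T] bounds the lattice
   points met. *)
pose T := (Num.truncn (4 + 2 * `|t|)).+1.
have HT : 4 + 2 * `|t| <= T%:R by apply: ltW; exact: truncnS_gt.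
(* The factor 2 absorbs the extra interval in the count [(Q n * T).+1]. *)
pose D := 2 * T%:R * (`|kap| * (3 + `|t|)).
have D0 : 0 <= D by rewrite /D !mulr_ge0// addr_ge0.
pose n := Num.truncn (D / eps).
have [Q0 q0 qL] := HQ n; have [p hp] := Hp n.
have QR : 1 <= (Q n)%:R :> R by rewrite ler1n.
have QR0 : 0 < (Q n)%:R :> R by rewrite ltr0n.
have nR : 0 < n.+2%:R :> R by rewrite ltr0n.
exists (Q n * T).+1, (fun l => `|kap| * (l%:R / (Q n)%:R)),
  (`|kap| * ((3 + `|t|) / ((Q n)%:R * n.+2%:R))); split.
- by rewrite !mulr_ge0// ?invr_ge0 ?mulr_ge0 ?addr_ge0.
- apply: (@le_trans _ _ (D / n.+2%:R)).
    have -> : D / n.+2%:R = (2 * (Q n)%:R * T%:R) * (`|kap| * ((3 + `|t|) / ((Q n)%:R * n.+2%:R))).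
      by rewrite /D; field; rewrite !lt0r_neq0.
    rewrite ler_wpM2r ?mulr_ge0 ?invr_ge0 ?addr_ge0 ?mulr_ge0//.
    rewrite -[(_ * _).+1]addn1 natrD natrM.
    have : 1 <= T%:R :> R by rewrite ler1n.
    by nra.
  rewrite ler_pdivrMr// mulrC -ler_pdivrMr//.
  apply: ltW; apply: lt_trans (truncnS_gt _) _.
  by rewrite ltr_nat.
move=> z /HA [d1 [d2 [-> hd1 hd2 /(_ n)[i [j [h1 h2]]]]]].
have [l hl] := @near_lattice_combination _ _ n.+2 _ _ t d1 d2 p i j gam Q0 isT q0 qL hp h1 h2 hd2.
set y := gam%:R * d1 + t * d2 in hl *.
have hy : `|y| <= 1 + `|t|.
  apply: le_trans (ler_normD _ _) _; rewrite !normrM; apply: lerD.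
    by move: {hl y HA}gam => []; rewrite ?normr1 ?normr0 ?mul1r ?mul0r.
  by rewrite ler_piMr.
have eQ : `|l%:~R / (Q n)%:R| = `|l|%:R / (Q n)%:R :> R.
  by rewrite normrM natr_absz intr_norm (@gtr0_norm _ (_^-1)) ?invr_gt0.
exists `|l|%N; last first.
  rewrite normrM -mulrBr normrM normr_id ler_wpM2l//.
  apply: le_trans hl; rewrite -eQ; exact: ler_dist_dist.
rewrite ltnS -(ler_nat R) natrM mulrC -ler_pdivrMr// -eQ.
have e1 : ((Q n)%:R * n.+2%:R)^-1 <= 1 :> R.
  by rewrite invf_le1 ?mulr_gt0// -natrM ler1n muln_gt0 Q0.
have h3 : (3 + `|t|) / ((Q n)%:R * n.+2%:R) <= 3 + `|t|.
  by rewrite ler_piMr// addr_ge0.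
apply: le_trans HT.
have -> : l%:~R / (Q n)%:R = y - (y - l%:~R / (Q n)%:R) by rewrite subKr.
by apply: le_trans (ler_normB _ _) _; have := le_trans hl h3; lra.
Qed.

(** * Lower bounds for Hausdorff dimension *)

Lemma edist_le_ediam (R : realType) (U : set (R * R)) (delta : R) (x y : R * R) :
  (forall x y, U x -> U y -> Defs.edist x y <= delta) -> U x -> U y ->
  Defs.edist x y <= ediam U.
Proof.
move=> Ud Ux Uy; apply: ub_le_sup; last by exists x => //; exists y.
by exists delta => _ [a Ua [b Ub <-]]; exact: Ud.
Qed.

(* The pullback of Lebesgue outer measure on the unit square along [phi] plays
   the part of the Frostman measure; no measurability of [phi] is needed. *)
Lemma hausdorff_measure_gt0 (R : realType) (E : set (R * R)) (s1 s2 C1 C2 : R)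
    (phi : R * R -> R * R) :
  0 <= s1 -> 0 <= s2 -> 0 < C1 -> 0 < C2 ->
  (forall p, 0 <= p.1 < 1 -> 0 <= p.2 < 1 -> E (phi p)) ->
  (forall p p', 0 <= p.1 < 1 -> 0 <= p.2 < 1 -> 0 <= p'.1 < 1 -> 0 <= p'.2 < 1 ->
    `|p.1 - p'.1| <= C1 * Defs.edist (phi p) (phi p') `^ s1 /\
    `|p.2 - p'.2| <= C2 * Defs.edist (phi p) (phi p') `^ s2) ->
  (0 < hausdorff_measure (s1 + s2) E)%E.
Proof.
move=> s10 s20 C10 C20 phiE phiH.
(* The rectangles below have sides [2 C1 d ^ s1] and [2 C2 d ^ s2]. *)
pose c : R := 4 * C1 * C2.
have c0 : 0 < c by rewrite /c !mulr_gt0.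
apply: (@lt_le_trans _ _ (c^-1)%:E); first by rewrite lte_fin invr_gt0.
apply: le_trans (ereal_sup_ubound _); last by exists 1 => //=; exact: ltr01.
apply/ereal_infP => _ [U [cov Ud] <-].
rewrite -[leLHS]mule1.
apply: (@le_trans _ _ ((c^-1)%:E * (c%:E * \sum_(0 <= i <oo) hcontrib (s1 + s2) (U i)))%E); last first.
  by rewrite muleA -EFinM mulVf ?mul1e// gt_eqF.
apply: lee_wpmul2l; first by rewrite lee_fin invr_ge0 ltW.
have hc0 i : (0 <= hcontrib (s1 + s2) (U i))%E.
  by rewrite /hcontrib lee_fin; case: ifP => // _; exact: powR_ge0.
pose I01 : set R := `[0, 1[%classic.
pose V i := [set p : R * R | [/\ I01 p.1, I01 p.2 & U i (phi p)]].
(* The rectangle is centred at a point of [V i]; the Hoelder bounds limit how far the other points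
   of [V i] are from it. *)
have /choice[X] : forall i, exists X : set R * set R, [/\ measurable X.1, measurable X.2,
    V i `<=` X.1 `*` X.2 &
    (((@lebesgue_measure R) \x (@lebesgue_measure R)) (X.1 `*` X.2)
      <= c%:E * hcontrib (s1 + s2) (U i))%E].
  move=> i; have [V0|/set0P [p0 [p01 p02 Up0]]] := eqVneq (V i) set0.
    exists (set0, set0); split => //=; first by rewrite V0.
    rewrite product_measure1E ?measure0 ?mule0//.
    by rewrite mule_ge0// lee_fin ltW.
  pose d := ediam (U i).
  have d0 : 0 <= d.
    by apply: le_trans _ (edist_le_ediam _ _ _ _ _ (Ud i) Up0 Up0); exact: sqrtr_ge0.
  have r0 (r : R) : 0 <= d `^ r by exact: powR_ge0.
  pose J (a r : R) : set R := `[a - r, a + r]%classic.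
  have JL a r : 0 <= r -> lebesgue_measure (J a r) = (2 * r)%:E.
    move=> r1; rewrite /J lebesgue_measure_itv/= lte_fin.
    case: ltP => [_|h]; first by rewrite -EFinD; congr (_%:E); ring.
    by congr (_%:E); lra.
  exists (J p0.1 (C1 * d `^ s1), J p0.2 (C2 * d `^ s2)); split => /=.
  - exact: measurable_itv.
  - exact: measurable_itv.
  - move=> p [p1 p2 Up]; move: p1 p2 p01 p02.
    rewrite /I01/= !in_itv/= => p1 p2 p01 p02.
    have [h1 h2] := phiH _ _ p1 p2 p01 p02.
    have hd : Defs.edist (phi p) (phi p0) <= d by exact: edist_le_ediam _ _ _ _ _ (Ud i) Up Up0.
    have hp (r : R) : 0 <= r -> Defs.edist (phi p) (phi p0) `^ r <= d `^ r.
      by move=> rp; apply: ge0_ler_powR; rewrite ?nnegrE ?sqrtr_ge0.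
    split; rewrite /J/= in_itv/= -ler_distl.
      by apply: le_trans h1 _; rewrite ler_pM2l// hp.
    by apply: le_trans h2 _; rewrite ler_pM2l// hp.
  - rewrite product_measure1E; [|exact: measurable_itv|exact: measurable_itv].
    rewrite /= !JL ?mulr_ge0 ?(ltW C10) ?(ltW C20)// -EFinM /hcontrib ifF; last first.
      by apply/eqP => U0; move: Up0; rewrite U0.
    rewrite -EFinM lee_fin -/d.
    have -> : d `^ (s1 + s2) = d `^ s1 * d `^ s2.
      (* The base [d] can be 0, so adding exponents requires a nonzero sum. *)
      have [s0|s0] := eqVneq (s1 + s2) 0.
        have [-> ->] : s1 = 0 /\ s2 = 0 by split; lra.
        by rewrite addr0 !powRr0 mulr1.
      by rewrite powRD// (negbTE s0).
    by rewrite le_eqVlt; apply/orP; left; apply/eqP; rewrite /c; ring.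
move=> HX.
rewrite -nneseriesZl//.
have <- : ((@lebesgue_measure R) \x (@lebesgue_measure R))%E (I01 `*` I01) = 1%E.
  rewrite product_measure1E; [|exact: measurable_itv|exact: measurable_itv].
  have L01 : lebesgue_measure I01 = 1%E.
    by rewrite lebesgue_measure_itv/= lte_fin ltr01 oppr0 adde0.
  by rewrite /= L01 mule1.
apply: (@le_trans _ _ (\sum_(0 <= i <oo) ((@lebesgue_measure R) \x (@lebesgue_measure R)) ((X i).1 `*` (X i).2))%E).
  apply: measure_sigma_subadditive.
  - by move=> i; apply: measurableX; case: (HX i).
  - by apply: measurableX; exact: measurable_itv.
  - move=> p [p1 p2].
    have [i _ Ui] : (\bigcup_i U i) (phi p).
      by apply/cov/phiE; [move: p1|move: p2]; rewrite /I01/= in_itv/=.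
    by exists i => //; case: (HX i) => _ _ + _; apply; split.
by apply: lee_nneseries => // i _; case: (HX i).
Qed.

(** * The choice of scales *)

(** Pigeonhole: among [L ^ #|J| + 1] multiples of [t] modulo 1, two fall into the same cube of side
    [1 / L], and [q] is the difference of their indices. *)
Lemma dirichlet_simultaneous (R : realType) (J : finType) (t : J -> R) (L : nat) :
  (0 < L)%N ->
  exists q : nat, (0 < q <= L ^ #|J|)%N /\
    forall j, exists p : int, `|q%:R * t j - p%:~R| <= (L%:R)^-1.
Proof.
move=> L0; have LR : 0 < L%:R :> R by rewrite ltr0n.
pose fr (m : nat) j : R := m%:R * t j - (Num.floor (m%:R * t j))%:~R.
have fr0 m j : 0 <= fr m j by rewrite subr_ge0 floor_le.
have fr1 m j : fr m j < 1.
  by rewrite ltrBlDl -[X in _ < _ + X]/(1%:~R) -intrD floorD1_gt.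
pose box (m : nat) j := Num.truncn (L%:R * fr m j).
have boxP m j : (box m j)%:R <= L%:R * fr m j < (box m j).+1%:R.
  by rewrite truncn_itv// mulr_ge0// ltW.
have boxL m j : (box m j < L)%N.
  rewrite /box truncn_lt_nat ?mulr_ge0// ?ltW//.
  by rewrite -[ltRHS]mulr1 ltr_pM2l.
pose F (m : 'I_(L ^ #|J|).+1) : {ffun J -> 'I_L} := [ffun j => Ordinal (boxL m j)].
have [m1 [m2 [m12 eF]]] : exists m1 m2 : 'I_(L ^ #|J|).+1, (m1 < m2)%N /\ F m1 = F m2.
  have : ~ injective F.
    by move=> /leq_card; rewrite card_ffun !card_ord ltnn.
  move=> nF; apply: contra_notP nF => nF m1 m2 eF; apply/val_inj => /=.
  by case: (ltngtP m1 m2) => // mm; exfalso; apply: nF; [exists m1, m2|exists m2, m1].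
exists (m2 - m1)%N; split.
  by have := ltn_ord m2; lia.
move=> j; have e : box m1 j = box m2 j.
  by have := congr1 (fun f : {ffun J -> 'I_L} => val (f j)) eF; rewrite !ffunE.
exists (Num.floor (m2%:R * t j) - Num.floor (m1%:R * t j)).
rewrite natrB ?(ltnW m12)// intrB.
have -> : (m2%:R - m1%:R) * t j - ((Num.floor (m2%:R * t j))%:~R - (Num.floor (m1%:R * t j))%:~R)
  = fr m2 j - fr m1 j by rewrite /fr; ring.
have /andP[a1 b1] := boxP m1 j; have /andP[a2 b2] := boxP m2 j.
move: a1 b1 a2 b2; rewrite e -[(box m2 j).+1]addn1 natrD => a1 b1 a2 b2.
rewrite -(ler_pM2l LR) divff ?gt_eqF// -[X in X * _](gtr0_norm LR) -normrM mulrBr.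
by rewrite ler_norml; apply/andP; split; lra.
Qed.

(** The slopes 0 and 1 are integers, so only the other [K - 2] enter the exponent; this is the
    source of the dimension [1 / (K - 1)]. *)
Lemma dirichlet_with_integers (R : realType) (I : finType) (t : I -> R) (i1 i2 : I)
    (K L : nat) :
  i1 != i2 -> t i1 = 0 -> t i2 = 1 -> (#|I| <= K)%N -> (0 < L)%N ->
  exists q : nat, (0 < q <= L ^ (K - 2))%N /\
    forall i, exists p : int, `|q%:R * t i - p%:~R| <= (L%:R)^-1.
Proof.
move=> i12 t1 t2 cI L0.
pose J := {i : I | (i != i1) && (i != i2)}.
have [q [/andP[q0 qL] hq]] := @dirichlet_simultaneous R J (fun j => t (val j)) L L0.
exists q; split.
  rewrite q0 (leq_trans qL)// leq_pexp2l// card_sig.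
  have := cardC (pred2 i1 i2); rewrite card2 i12/= => cC.
  have : #|[pred i | (i != i1) && (i != i2)]| = #|predC (pred2 i1 i2)|.
    by apply: eq_card => i; rewrite !inE negb_or.
  by move=> ->; move: cC cI; move: #|_| #|_| => a b; lia.
move=> i; have [->|n1] := eqVneq i i1.
  by exists 0; rewrite t1 mulr0 subrr normr0 invr_ge0.
have [->|n2] := eqVneq i i2.
  by exists q; rewrite t2 mulr1 -pmulrn subrr normr0 invr_ge0.
have ni : (i != i1) && (i != i2) by rewrite n1.
by have [p hp] := hq (Sub i ni); exists p; move: hp; rewrite SubK.
Qed.

(* The power [n.+1] makes [radix d n p] dominate all the earlier scales, which
   are accumulated in [p]. *)
Definition radix (d n p : nat) : nat := ((p * n.+2) ^ d.+1) ^ n.+1.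

(** The denominator shared by both Cantor sets after [n] stages. The radix is chosen before the
    Dirichlet multiplier, whose precision depends on it. *)
Fixpoint scale (d : nat) (qf : nat -> nat) (n : nat) : nat :=
  if n is m.+1 then
    let p := scale d qf m in
    (p * (radix d m p * qf (p * m.+2 * radix d m p) * m.+2))%N
  else 1%N.

(** One product [r * q * n.+2] is split in two ways into a free and a zero digit: [r * q] and [n.+2]
    for the first set, [r] and [q * n.+2] for the second. Hence both share the denominators [P n],
    with spacings [1 / Q] and [q / Q]. *)
Lemma lattice_scales (R : realType) (I : finType) (t : I -> R) (d : nat) :
  (forall L, (0 < L)%N -> exists q : nat, (0 < q <= L ^ d)%N /\
    forall i, exists p : int, `|q%:R * t i - p%:~R| <= (L%:R)^-1) ->
  exists b1 c1 b2 c2 Q q L : nat -> nat,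
  [/\ forall n, [/\ 1 < b1 n, 1 < c1 n, 1 < b2 n & 1 < c2 n]%N,
      (forall n, [/\ (0 < Q n)%N, (0 < q n)%N & (q n * L n = Q n * n.+2)%N]) /\
      (forall n i, exists p : int, `|(q n)%:R * t i - p%:~R| <= (L n)%:R^-1),
      forall n, (\prod_(i < n) (b1 i * c1 i) * b1 n = Q n)%N /\ c1 n = n.+2,
      forall n, (\prod_(i < n) (b2 i * c2 i) * b2 n * q n = Q n)%N /\ c2 n = (q n * n.+2)%N &
      forall n,
        ((\prod_(i < n.+1) (b1 i * c1 i)) ^ n.+1 <= b1 n ^ (1 * n.+1).+1)%N /\
        ((\prod_(i < n.+1) (b2 i * c2 i)) ^ n.+1 <= b2 n ^ (d.+1 * n.+1).+1)%N].
Proof.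
move=> H.
have /choice[qf qP] : forall L, exists q : nat, (0 < L)%N -> (0 < q <= L ^ d)%N /\
    forall i, exists p : int, `|q%:R * t i - p%:~R| <= (L%:R)^-1.
  by case=> [|L]; [exists 0%N|have [q Hq] := H L.+1 isT; exists q].
pose P := scale d qf; pose r n := radix d n (P n).
pose L n := (P n * n.+2 * r n)%N; pose q n := qf (L n).
have PS n : P n.+1 = (P n * (r n * q n * n.+2))%N by [].
have pos n : (0 < P n)%N /\ (1 < r n)%N.
  have rP m : (0 < P m)%N -> (1 < r m)%N.
    move=> Pm; have p2 : (1 < P m * m.+2)%N by rewrite (@leq_trans m.+2)// leq_pmull.
    by rewrite /r /radix -expnM -(exp1n (d.+1 * m.+1)) ltn_exp2r ?muln_gt0.
  suff Pn : (0 < P n)%N by split=> //; exact: rP.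
  elim: n => // n IH; rewrite PS !muln_gt0 IH (ltnW (rP _ IH)) /= andbT.
  by have [|/andP[]] := qP (L n); rewrite ?muln_gt0 ?IH ?(ltnW (rP _ IH)).
have L0 n : (0 < L n)%N.
  by have [P0 r1] := pos n; rewrite !muln_gt0 P0 (ltnW r1).
have q0 n : (0 < q n)%N by have [/andP[]] := qP _ (L0 n).
have qL n : (q n <= L n ^ d)%N by have [/andP[]] := qP _ (L0 n).
have prod1 n : (\prod_(i < n) (r i * q i * i.+2) = P n)%N.
  by elim: n => [|n IH]; rewrite ?big_ord0// big_ord_recr/= IH PS.
have prod2 n : (\prod_(i < n) (r i * (q i * i.+2)) = P n)%N.
  by rewrite -prod1; apply: eq_bigr => i _; rewrite mulnA.
exists (fun n => r n * q n)%N, (fun n => n.+2), r, (fun n => q n * n.+2)%N,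
  (fun n => P n * (r n * q n))%N, q, L; split.
- move=> n; have [P0 r1] := pos n; split=> //.
    by rewrite (leq_trans r1)// leq_pmulr.
  by rewrite (@leq_trans n.+2)// leq_pmull.
- split=> n; last by move=> i; have [_] := qP _ (L0 n); apply.
  have [P0 r1] := pos n; rewrite !muln_gt0 P0 (ltnW r1) q0; split=> //.
  by rewrite /L; ring.
- by move=> n; rewrite prod1.
- by move=> n; rewrite prod2 mulnA.
move=> n; have [P0 r1] := pos n; rewrite prod1 prod2; split.
  have -> : P n.+1 = (r n * q n * (P n * n.+2))%N by rewrite PS; ring.
  rewrite expnMn mul1n [leqRHS]expnSr leq_mul2l; apply/orP; right.
  apply: (@leq_trans (r n)); last by rewrite leq_pmulr.
  rewrite /r /radix leq_exp2r// -[leqLHS]expn1 leq_pexp2l// muln_gt0 P0.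
  by [].
(* As [q n <= L n ^ d], [P n.+1] is at most [L n ^ d.+1]; here [L n] is [P n * n.+2] times [r n],
   and [r n] equals [P n * n.+2] to the power [d.+1 * n.+1]. *)
apply: (@leq_trans ((L n ^ d.+1) ^ n.+1)).
  rewrite leq_exp2r// expnS.
  have -> : P n.+1 = (L n * q n)%N by rewrite PS /L; ring.
  by rewrite leq_mul2l qL orbT.
by rewrite /L expnMn expnMn -expnM -expnM expnM -/(radix d n (P n)) -/(r n) expnS.
Qed.

(** * Transfer to the plane and conclusion *)

(** Cramer's rule: the inverse of the affine chart is Lipschitz. *)
Lemma affine_coordinates_le (R : realType) (e f : R * R) :
  det2 e f != 0 -> exists2 M : R, 0 < M & forall u w u' w' : R,
    let phi (u w : R) := (2^-1 + (u * e.1 + w * f.1), 2^-1 + (u * e.2 + w * f.2)) in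
    `|u - u'| <= M * Defs.edist (phi u w) (phi u' w') /\
    `|w - w'| <= M * Defs.edist (phi u w) (phi u' w').
Proof.
move=> D0.
have Dp : 0 < `|det2 e f| by rewrite normr_gt0.
pose S := `|e.1| + `|e.2| + (`|f.1| + `|f.2|).
have S0 : 0 <= S by rewrite !addr_ge0.
exists ((1 + S) / `|det2 e f|); first by rewrite divr_gt0//; lra.
move=> u w u' w'; rewrite /Defs.edist/=.
have -> : 2^-1 + (u * e.1 + w * f.1) - (2^-1 + (u' * e.1 + w' * f.1)) =
  (u - u') * e.1 + (w - w') * f.1 by ring.
have -> : 2^-1 + (u * e.2 + w * f.2) - (2^-1 + (u' * e.2 + w' * f.2)) =
  (u - u') * e.2 + (w - w') * f.2 by ring.
set a := (u - u') * e.1 + _; set b := (u - u') * e.2 + _; set r := Num.sqrt _.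
have ar : `|a| <= r by rewrite -sqrtr_sqr ler_wsqrtr// lerDl sqr_ge0.
have br : `|b| <= r by rewrite -sqrtr_sqr ler_wsqrtr// lerDr sqr_ge0.
have r0 : 0 <= r by exact: sqrtr_ge0.
have eu : (u - u') * det2 e f = a * f.2 - b * f.1 by rewrite /det2 /a /b; ring.
have ew : (w - w') * det2 e f = b * e.1 - a * e.2 by rewrite /det2 /a /b; ring.
have key (x y z : R) : `|y| <= r -> `|z| <= r ->
    forall g h : R, `|g| + `|h| <= S -> x * det2 e f = y * g - z * h ->
    `|x| <= (1 + S) / `|det2 e f| * r.
  move=> yr zr g h gh ex; rewrite mulrAC ler_pdivlMr// -normrM ex.
  apply: le_trans (ler_normB _ _) _; rewrite !normrM.
  apply: (@le_trans _ _ (r * (`|g| + `|h|))).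
    by rewrite mulrDr lerD// ler_wpM2r.
  by rewrite mulrC ler_wpM2r//; lra.
split.
  apply: (key _ a b ar br f.2 f.1) => //.
  by rewrite /S [leLHS]addrC lerDr addr_ge0.
apply: (key _ b a br ar e.1 e.2) => //.
by rewrite /S lerDl addr_ge0.
Qed.

(** A smaller exponent [s] of measure zero would be [lam * s0] with [lam = s / s0] below 1. *)
Lemma hausdorff_dim_ge (R : realType) (E : set (R * R)) (s0 : R) : 0 < s0 ->
  (forall lam, 0 <= lam < 1 -> (0 < hausdorff_measure (lam * s0) E)%E) ->
  (s0%:E <= hausdorff_dim E)%E.
Proof.
move=> s00 H; apply/ereal_infP => _ [s [sge Hs] <-]; rewrite lee_fin leNgt.
apply/negP => ss0; have := H (s / s0).
rewrite divfK ?gt_eqF// Hs ltxx => K; suff : false by [].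
by apply: K; rewrite divr_ge0 ?(ltW s00)//= ltr_pdivrMr// mul1r.
Qed.

Lemma negligible_finite_union (R : realType) (I : finType) (A : set R) (F : I -> set R) :
  (forall z, A z -> exists i, F i z) ->
  (forall i, (@lebesgue_measure R).-negligible (F i)) ->
  (@lebesgue_measure R).-negligible A.
Proof.
move=> AF Fn.
have AU : A `<=` \big[setU/set0]_(i : I) F i.
  by move=> z /AF[i Fi]; rewrite -bigcup_seq; exists i => //=; rewrite mem_index_enum.
apply: (@negligibleS _ _ _ (@lebesgue_measure R) _ _ AU).
elim/big_ind: _ => //; [exact: negligible_set0|].
by move=> B C; exact: (@negligibleU _ _ _ (@lebesgue_measure R)).
Qed.

Lemma dist_sub_itv_le (R : realType) (u u' a a' r : R) :
  a <= u <= a + r -> a' <= u' <= a' + r -> `|u - u' - (a - a')| <= r.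
Proof.
by move=> /andP[? ?] /andP[? ?]; rewrite ler_norml; apply/andP; split; lra.
Qed.

Theorem theorem1 (R : realType) (K : nat) (N : R * R -> R) :
  (2 <= K)%N ->
  is_norm2 N ->
  symmetric_set [set x | N x <= 1] ->
  convex_polygon_with_sides (2 * K) [set x | N x <= 1] ->
  exists E : set (R * R),
    [/\ E `<=` [set x | 0 <= x.1 <= 1 /\ 0 <= x.2 <= 1],
        ((K%:R / (K%:R - 1))%:E <= hausdorff_dim E)%E &
        (@lebesgue_measure R).-negligible (distance_set N E)].
Proof.
move=> K2 Nn Nsym Npoly.
have [I [p [cI Np]]] := polygon_norm_functionals _ _ _ Nn Nsym Npoly.
have [e [f [i1 [i2 [kap [t [gam [D0 [ef1 ef2] [i12 t1 t2] HN]]]]]]]] :=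
  adapted_coordinates _ _ _ _ Nn Np.
have [b1 [c1 [b2 [c2 [Q [q [L [bc [HQ Ht] H1 H2 Hg]]]]]]]] :=
  lattice_scales _ _ _ _ (fun L L0 => dirichlet_with_integers _ _ _ _ _ _ L i12 t1 t2 cI L0).
have b10 i : (0 < b1 i)%N by have [/ltnW] := bc i.
have c10 i : (0 < c1 i)%N by have [_ /ltnW] := bc i.
have b20 i : (0 < b2 i)%N by have [_ _ /ltnW] := bc i.
have c20 i : (0 < c2 i)%N by have [_ _ _ /ltnW] := bc i.
pose phi (u w : R) := (2^-1 + (u * e.1 + w * f.1), 2^-1 + (u * e.2 + w * f.2)).
pose Phi (z : R * R) := phi (cantor_map b1 c1 z.1) (cantor_map b2 c2 z.2).
exists (Phi @` [set z | 0 <= z.1 < 1 /\ 0 <= z.2 < 1]); split.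
- move=> _ [[x y] /= [/andP[x0 x1] /andP[y0 y1]] <-]; rewrite /Phi /phi/=.
  have := cantor_map_ge0_le1 _ _ _ _ b10 c10 x0; have := cantor_map_ge0_le1 _ _ _ _ b20 c20 y0.
  move: (cantor_map _ _ x) (cantor_map _ _ y) => u w /andP[w0 w1] /andP[u0 u1].
  have key (g h : R) : `|g| + `|h| <= 2^-1 -> 0 <= 2^-1 + (u * g + w * h) <= 1.
    move=> gh; suff : `|u * g + w * h| <= 2^-1.
      by rewrite ler_norml => /andP[? ?]; apply/andP; split; lra.
    apply: le_trans gh; apply: le_trans (ler_normD _ _) _.
    by apply: lerD; rewrite normrM ler_piMl// ger0_norm.
  by split; apply: key.
- have K1 : 0 < K%:R - 1 :> R by rewrite subr_gt0 ltr1n.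
  apply: hausdorff_dim_ge; first by rewrite divr_gt0// ltr0n; lia.
  move=> lam /andP[lam0 lam1].
  have dK : (K - 2).+1%:R = K%:R - 1 :> R.
    by apply: (addIr 1); rewrite subrK natr1; congr (_%:R); lia.
  (* [K / (K - 1)] is [1 + 1 / (K - 1)]: the two summands are the Hoelder exponents of the two
     Cantor sets as [lam] tends to 1. *)
  have -> : lam * (K%:R / (K%:R - 1)) = lam / 1%:R + lam / (K - 2).+1%:R.
    by rewrite dK; field; rewrite lt0r_neq0.
  have P1 n : (0 < \prod_(i < n) (b1 i * c1 i))%N.
    by apply: prodn_gt0 => i; rewrite muln_gt0 b10 c10.
  have P2 n : (0 < \prod_(i < n) (b2 i * c2 i))%N.
    by apply: prodn_gt0 => i; rewrite muln_gt0 b20 c20.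
  have l01 : 0 <= lam < 1 by rewrite lam0.
  have [C1 HC1] := growth_hoelder_exponent R b1 _ 1 lam isT b10 P1 l01 (fun n => (Hg n).1).
  have [C2 HC2] := growth_hoelder_exponent R b2 _ (K - 2).+1 lam isT b20 P2 l01 (fun n => (Hg n).2).
  have s1 : 0 <= lam / 1%:R <= 1 by rewrite divr1 lam0 ltW.
  have s2 : 0 <= lam / (K - 2).+1%:R <= 1.
    rewrite divr_ge0//= ler_pdivrMr ?ltr0n// mul1r (le_trans (ltW lam1))//.
    by rewrite ler1n.
  have hC (b c : nat -> nat) (s C : R) :
    (forall n, (\prod_(i < n) (b i * c i))%:R `^ s <= C * (\prod_(i < n) b i)%:R) -> 0 < C.
    by move=> /(_ 0%N); rewrite !big_ord0 powR1 mulr1; apply: lt_le_trans.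
  have [M M0 HM] := affine_coordinates_le _ _ _ D0.
  apply: (hausdorff_measure_gt0 _ _ _ _ (4 * C1 * M `^ (lam / 1%:R))
    (4 * C2 * M `^ (lam / (K - 2).+1%:R)) Phi).
  + by case/andP: s1.
  + by case/andP: s2.
  + by rewrite !mulr_gt0 ?powR_gt0// (hC _ _ _ _ HC1).
  + by rewrite !mulr_gt0 ?powR_gt0// (hC _ _ _ _ HC2).
  + by move=> z z1 z2; exists z.
  + move=> z z' z1 z2 z1' z2'.
    have [hu hw] := HM (cantor_map b1 c1 z.1) (cantor_map b2 c2 z.2)
      (cantor_map b1 c1 z'.1) (cantor_map b2 c2 z'.2).
    have key (s C x y : R) : 0 <= s -> 0 < C -> `|x| <= 4 * C * `|y| `^ s ->
        `|y| <= M * Defs.edist (Phi z) (Phi z') ->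
        `|x| <= 4 * C * M `^ s * Defs.edist (Phi z) (Phi z') `^ s.
      move=> s0 C0 hx hy; apply: (le_trans hx); rewrite -[leRHS]mulrA ler_pM2l ?mulr_gt0//.
      rewrite -powRM ?(ltW M0) ?sqrtr_ge0//.
      by apply: ge0_ler_powR; rewrite ?nnegrE// mulr_ge0 ?(ltW M0) ?sqrtr_ge0.
    split.
      apply: key hu; [by case/andP: s1|exact: hC HC1|].
      by apply: cantor_map_hoelder => // i; have [] := bc i.
    apply: key hw; [by case/andP: s2|exact: hC HC2|].
    by apply: cantor_map_hoelder => // i; have [] := bc i.
(* [F k] collects the distances given by the [k]-th functional, with the lattice approximations that
   make it null. *)
pose F k := [set z : R | exists d1 d2 : R,
     [/\ z = `|kap k * ((gam k)%:R * d1 + t k * d2)|, `|d1| <= 1, `|d2| <= 1 &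
       forall n, exists i j : int, `|d1 - i%:~R / (Q n)%:R| <= ((Q n)%:R * n.+2%:R)^-1 /\
         `|d2 - j%:~R * (q n)%:R / (Q n)%:R| <= ((Q n)%:R * n.+2%:R)^-1]].
apply: (negligible_finite_union _ _ _ F); last first.
  by move=> k; apply: (negligible_lattice_combinations _ (F k) (kap k) (t k) (gam k) Q q L HQ).
move=> _ [_ [x [/andP[x1 _] /andP[x2 _]] <-] [_ [y [/andP[y1 _] /andP[y2 _]] <-] <-]].
set u := cantor_map b1 c1 x.1; set w := cantor_map b2 c2 x.2.
set u' := cantor_map b1 c1 y.1; set w' := cantor_map b2 c2 y.2.
have [k hk] := HN (u - u') (w - w').
exists k, (u - u'), (w - w'); split.
- rewrite -hk /Phi /phi/= -/u -/w -/u' -/w'. by congr (N (_, _)); ring.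
- have := dist_sub_itv_le R u u' 0 0 1; rewrite subrr subr0 add0r; apply.
    exact: cantor_map_ge0_le1.
  exact: cantor_map_ge0_le1.
- have := dist_sub_itv_le R w w' 0 0 1; rewrite subrr subr0 add0r; apply.
    exact: cantor_map_ge0_le1.
  exact: cantor_map_ge0_le1.
move=> n.
have [j1 /= hj1] := cantor_map_lattice _ _ _ _ n b10 c10 x1.
have [j1' /= hj1'] := cantor_map_lattice _ _ _ _ n b10 c10 y1.
have [j2 /= hj2] := cantor_map_lattice _ _ _ _ n b20 c20 x2.
have [j2' /= hj2'] := cantor_map_lattice _ _ _ _ n b20 c20 y2.
exists (j1%:Z - j1'%:Z), (j2%:Z - j2'%:Z); rewrite !intrB -!pmulrn.
have [Q0 q0 _] := HQ n; have [e1 e1'] := H1 n; have [e2 e2'] := H2 n.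
split.
  move: hj1 hj1'; rewrite e1 e1' mulrBl; exact: dist_sub_itv_le.
have qR : (q n)%:R != 0 :> R by rewrite pnatr_eq0 -lt0n.
have QR : (\prod_(i < n) (b2 i * c2 i) * b2 n)%:R != 0 :> R.
  by rewrite pnatr_eq0 -lt0n; move: Q0; rewrite -e2 muln_gt0 => /andP[].
(* For the second set [Q] contains the additional factor [q], so its lattice has spacing [q / Q];
   the factor [q] in [c2] restores the error [1 / (Q * n.+2)]. *)
have eQ (j : nat) : j%:R / (\prod_(i < n) (b2 i * c2 i) * b2 n)%:R
    = j%:R * (q n)%:R / (Q n)%:R :> R.
  rewrite -e2; move: (_ * b2 n)%N QR => z zR.
  by rewrite natrM; field; rewrite zR qR.
have eC : (\prod_(i < n) (b2 i * c2 i) * b2 n)%:R * (c2 n)%:R = (Q n)%:R * n.+2%:R :> R.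
  by rewrite -!natrM e2' -e2 mulnA.
move: hj2 hj2'; rewrite !eQ eC !mulrBl; exact: dist_sub_itv_le.
Qed.
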